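(* Let $\Sigma$ be a positive integer and $n$ a nonnegative integer. The number of partitions of $n$ in which every part occurs at most $2$ times and whose alternating sum type (for modulus $m=3$) is $(\Sigma,2)$ equals the number of partitions of $n$ with no part divisible by $3$ that have exactly $\Sigma$ parts congruent to $1$ modulo $3$ and exactly $2$ parts congruent to $2$ modulo $3$. Likewise, the number of partitions of $n$ in which every part occurs at most $2$ times and whose alternating sum type is $(2,\Sigma)$ equals the number of partitions of $n$ with no part divisible by $3$ that have exactly $2$ parts congruent to $1$ modulo $3$ and exactly $\Sigma$ parts congruent to $2$ modulo $3$.
   Context: Fix an integer modulus $m\ge 2$. For a partition $\lambda_1\ge\lambda_2\ge\dots\ge\lambda_r>0$, append zero parts $\lambda_{r+1}=\lambda_{r+2}=\dots=0$ so that its length becomes a multiple $km$ of $m$ (zeros are allowed as parts for this purpose only). The alternating sum type of $\lambda$ is the $(m-1)$-tuple $(\Sigma_1,\dots,\Sigma_{m-1})$ with $\Sigma_j=\sum_{i=1}^{k}\big(\lambda_{(i-1)m+j}-\lambda_{(i-1)m+j+1}\big)$ for $1\le j\le m-1$. For $m=3$: $\Sigma_1=\sum_i(\lambda_{3i-2}-\lambda_{3i-1})$, $\Sigma_2=\sum_i(\lambda_{3i-1}-\lambda_{3i})$. *)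

(* Defs.v *)
From HB Require Import structures.
From mathcomp Require Import all_boot.

Set Implicit Arguments.
Unset Strict Implicit.
Unset Printing Implicit Defensive.

Definition is_intpart (n : nat) (s : seq nat) : bool :=
  [&& sorted geq s, all (leq 1) s & sumn s == n].

Record intpart (n : nat) : Type := IntPart {
  parts :> seq nat;
  _ : is_intpart n parts
}.

HB.instance Definition _ (n : nat) := [isSub for @parts n].
HB.instance Definition _ (n : nat) := [Countable of intpart n by <:].

Lemma intpart_size (n : nat) (p : intpart n) : size p <= n.
Proof.
case: p => s /= /and3P[_ pos /eqP <-].
by elim: s pos => //= x s IH /andP[x0 /IH]; rewrite -add1n; apply: leq_add.
Qed.

Lemma intpart_leq (n : nat) (p : intpart n) : all (geq n) p.
Proof.
case: p => s /= /and3P[_ _ /eqP <-]; apply/allP => x /=.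
elim: s => //= y s IH; rewrite inE => /orP[/eqP -> | /IH h].
  exact: leq_addr.
exact: leq_trans h (leq_addl _ _).
Qed.

(* Partitions of n have at most n parts, all at most n: this makes
   [intpart n] a finite type. *)
Definition intpart_enc (n : nat) (p : intpart n) : {bseq n of 'I_n.+1} :=
  insub_bseq n [seq inord x | x <- p].

Definition intpart_dec (n : nat) (b : {bseq n of 'I_n.+1}) :
  option (intpart n) := insub [seq val i | i <- b].

Lemma intpart_encK (n : nat) : pcancel (@intpart_enc n) (@intpart_dec n).
Proof.
move=> p; rewrite /intpart_dec /intpart_enc.
have -> : [seq val i | i <- insub_bseq n [seq @inord n x | x <- p]] = p :> seq nat.
  rewrite /insub_bseq /insubd insubT /= ?size_map ?intpart_size // => _.
  rewrite -map_comp -[RHS]map_id; apply/eq_in_map => x xp /=.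
  by rewrite inordK // ltnS; apply: (allP (intpart_leq p)).
exact: valK.
Qed.

Definition intpart_enum (n : nat) : seq (intpart n) :=
  undup (pmap (@intpart_dec n) (enum {: {bseq n of 'I_n.+1}})).

Lemma intpart_enumP (n : nat) : Finite.axiom (intpart_enum n).
Proof.
move=> p; rewrite count_uniq_mem ?undup_uniq // mem_undup mem_pmap.
by apply/eqP; rewrite eqb1 -(intpart_encK p) map_f // mem_enum.
Qed.

HB.instance Definition _ (n : nat) :=
  isFinite.Build (intpart n) (@intpart_enumP n).

(* Sigma_j for the modulus m, with j counted from 1: the sum over the
   k = ceil (size s / m) blocks of length m.  The part lambda_l is
   [nth 0 s l.-1], so the default value 0 supplies the appended zero parts.
   The truncated subtraction is exact because partitions are nonincreasing. *)
Definition alt_sum (m : nat) (s : seq nat) (j : nat) : nat :=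
  let k := (size s + m.-1) %/ m in
  \sum_(1 <= i < k.+1)
     (nth 0 s ((i - 1) * m + j).-1 - nth 0 s ((i - 1) * m + j + 1).-1).

Definition alt_sum_type (m : nat) (s : seq nat) : seq nat :=
  [seq alt_sum m s j | j <- iota 1 m.-1].

Definition mult_at_most (c : nat) (s : seq nat) : bool :=
  all (fun x => count_mem x s <= c) s.

Definition no_part_divisible (m : nat) (s : seq nat) : bool :=
  all (fun x => ~~ (m %| x)) s.

Definition num_parts_mod (m r : nat) (s : seq nat) : nat :=
  count (fun x => x == r %[mod m]) s.

(* Main.v *)
(** The statement holds for every modulus [m] and every type [t].  Conjugation
    turns alternating sums into numbers of parts in residue classes, so among
    all partitions of [n] the two types are equidistributed.  Removing [m] equal
    parts preserves the alternating sum type, just as removing a part divisible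
    by [m] preserves the numbers of parts in the nonzero classes.  Hence the
    number [N_c(n)] of partitions of [n] of type [t] in which the parts
    [1, ..., c] occur fewer than [m] times, and the number of those in which
    the parts [m, ..., m * c] do not occur, obey the same recurrence
    [N_(c+1)(n) = N_c(n) - N_c(n - m (c+1))] and agree for [c = 0].  Take
    [c = n]. *)

Require Import Defs.
From mathcomp Require Import all_boot zify.

Set Implicit Arguments.
Unset Strict Implicit.
Unset Printing Implicit Defensive.

(** * Conjugation of partitions *)

Definition conj_seq (s : seq nat) : seq nat :=
  mkseq (fun i => count (ltn i) s) (head 0 s).

Lemma geq_trans : transitive geq.
Proof. by move=> y x z /= xy yz; exact: leq_trans yz xy. Qed.

Lemma geq_total : total geq.
Proof. by move=> x y; exact: leq_total. Qed.

Lemma geq_anti : antisymmetric geq.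
Proof. by move=> x y; rewrite andbC => /anti_leq. Qed.

Lemma sorted_geq_head (s : seq nat) (x : nat) :
  sorted geq s -> x \in s -> x <= head 0 s.
Proof.
case: s => //= y s; rewrite path_sortedE; last exact: geq_trans.
by case/andP=> /allP ys _; rewrite inE => /orP[/eqP -> // | /ys].
Qed.

(** Both sides say that the cell in row [i] and column [l] lies in the Young diagram, since the
    parts exceeding [l] form a prefix of [s]. This symmetry makes [conj_seq] an involution. *)
Lemma ltn_count_sorted (s : seq nat) (i l : nat) :
  sorted geq s -> (i < count (ltn l) s) = (l < nth 0 s i).
Proof.
elim: s i => [|x s IH] i //=; first by rewrite nth_nil !ltn0.
rewrite path_sortedE; last exact: geq_trans.
case/andP=> xs /IH {}IH; case: (ltnP l x) => lx.
  by case: i => [|i] /=; [lia | rewrite add1n ltnS IH].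
have -> : count (ltn l) s = 0.
  apply/eqP; rewrite -leqn0 leqNgt -has_count -all_predC.
  by apply/allP => y /(allP xs) /= yx; lia.
case: i => [|i] /=; first by lia.
rewrite ltn0; case: (ltnP i (size s)) => si; last by rewrite nth_default ?ltn0.
by have := allP xs _ (mem_nth 0 si); rewrite /=; lia.
Qed.

Lemma nth_conj_seq (s : seq nat) (i : nat) :
  sorted geq s -> nth 0 (conj_seq s) i = count (ltn i) s.
Proof.
move=> s_sorted; case: (ltnP i (head 0 s)) => hi; first by rewrite nth_mkseq.
rewrite nth_default ?size_mkseq //; apply/esym/eqP.
rewrite -leqn0 leqNgt -has_count -all_predC; apply/allP => x xs /=.
by rewrite -leqNgt; exact: leq_trans (sorted_geq_head s_sorted xs) hi.
Qed.

Lemma conj_seq_sorted (s : seq nat) : sorted geq (conj_seq s).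
Proof.
rewrite /conj_seq /mkseq sorted_map.
apply: sub_sorted (iota_ltn_sorted 0 _) => i j /= ij.
by apply: sub_count => x /= jx; exact: ltn_trans jx.
Qed.

Lemma conj_seq_pos (s : seq nat) : all (leq 1) (conj_seq s).
Proof.
apply/allP => _ /mapP[i + ->]; rewrite mem_iota /= => hi.
rewrite -has_count; apply/hasP; exists (head 0 s) => //.
by case: s hi => //= x s _; rewrite mem_head.
Qed.

Lemma count_ltn_iota (h x : nat) : count (fun i => i < x) (iota 0 h) = minn h x.
Proof.
elim: h => [|h IH]; first by rewrite min0n.
by rewrite -addn1 iotaD count_cat IH /= add0n; lia.
Qed.

Lemma sumn_conj_seq (s : seq nat) :
  sorted geq s -> sumn (conj_seq s) = sumn s.
Proof.
move=> s_sorted; rewrite /conj_seq.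
have : all (fun x => x <= head 0 s) s.
  by apply/allP => x; exact: sorted_geq_head.
(* Only an upper bound [h] of the parts is kept, so that the induction can drop the head: a part [x]
   adds 1 to [minn h x = x] of the [h] columns. *)
move: (head 0 s) => h; clear s_sorted; elim: s => [|x s IH] /=.
  by move=> _; rewrite /mkseq; elim: (iota 0 h).
case/andP=> xh /IH <-; rewrite -{2}(minn_idPr xh) -count_ltn_iota /mkseq.
by elim: (iota 0 h) => //= i r ->; rewrite addnACA.
Qed.

Lemma conj_seqK (s : seq nat) :
  sorted geq s -> all (leq 1) s -> conj_seq (conj_seq s) = s.
Proof.
move=> s_sorted s_pos; apply: (@eq_from_nth _ 0) => [|i _].
  rewrite size_mkseq -nth0 nth_conj_seq //; apply/eqP.
  by rewrite -all_count.
rewrite nth_conj_seq ?conj_seq_sorted // /conj_seq count_map.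
rewrite (eq_count (a2 := fun l => l < nth 0 s i)) => [|l /=]; last first.
  by rewrite -ltn_count_sorted.
rewrite count_ltn_iota; apply/minn_idPr.
case: (ltnP i (size s)) => si; last by rewrite nth_default.
exact/sorted_geq_head/mem_nth.
Qed.

Lemma count_ltn_subS (s : seq nat) (i : nat) :
  count (ltn i) s - count (ltn i.+1) s = count_mem i.+1 s.
Proof.
suff -> : count (ltn i) s = count (ltn i.+1) s + count_mem i.+1 s by lia.
by elim: s => //= x s ->; lia.
Qed.

(** Consecutive parts of the conjugate, the [l]-th and the next one, differ by the multiplicity of
    [l] in [s]. The alternating sum thus adds the multiplicities of the numbers [i * m + j]. *)
Lemma alt_sum_conj (m j : nat) (s : seq nat) :
  0 < j < m -> sorted geq s ->
  alt_sum m (conj_seq s) j = num_parts_mod m j s.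
Proof.
move=> /andP[j_gt0 jm] s_sorted; rewrite /alt_sum /num_parts_mod size_mkseq.
rewrite big_add1 /= big_mkord.
transitivity (\sum_(i < (head 0 s + m.-1) %/ m) count_mem (i * m + j) s).
  apply: eq_bigr => i _; rewrite !nth_conj_seq // subn1 /=.
  rewrite addn1 /= -{2}(prednK (n := i * m + j)) ?count_ltn_subS ?prednK //; lia.
(* The rounded-up number of blocks reaches past every part; the inequality is strict because [j] is
   positive. *)
have : all (fun x => x < (head 0 s + m.-1) %/ m * m + j) s.
  apply/allP => x /(sorted_geq_head s_sorted) xh.
  have := divn_eq (head 0 s + m.-1) m.
  have := ltn_pmod (head 0 s + m.-1) (ltn_trans j_gt0 jm).
  by lia.
move: (_ %/ m) => k; clear s_sorted; elim: s => [|x s IH] /=.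
  by move=> _; rewrite big1.
case/andP=> xk /IH {}IH; rewrite big_split /= IH; congr (_ + _).
(* A part in the class of [j] is met in exactly one block, number [x %/ m]; any other part is met in
   none. *)
case: (altP (x %% m =P j %% m)) => [xj | xj].
  rewrite (modn_small jm) in xj.
  have x_eq : x = x %/ m * m + j by rewrite -xj -divn_eq.
  have qk : x %/ m < k.
    by rewrite -(ltn_pmul2r (ltn_trans j_gt0 jm)); lia.
  rewrite (bigD1 (Ordinal qk)) //= -x_eq eqxx big1 // => i /eqP iq.
  case: eqP => // xi; case: iq; apply/val_inj => /=.
  by rewrite xi divnMDl ?divn_small ?addn0 //; lia.
rewrite big1 // => i _; case: eqP => // xi; case/eqP: xj.
by rewrite xi modnMDl.
Qed.

Definition len_type (m : nat) (s : seq nat) : seq nat :=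
  [seq num_parts_mod m j s | j <- iota 1 m.-1].

Lemma alt_sum_type_conj (m : nat) (s : seq nat) :
  sorted geq s -> alt_sum_type m (conj_seq s) = len_type m s.
Proof.
move=> s_sorted; apply/eq_in_map => j; rewrite mem_iota => jm.
by apply: alt_sum_conj => //; lia.
Qed.

(** This is [alt_sum_conj] read for the conjugate of [s]. Columns beyond the diagram have length 0,
    which is not congruent to [j], so [B] is free and two partitions can be compared over a common
    range. *)
Lemma alt_sumE (m j B : nat) (s : seq nat) :
  0 < j < m -> sorted geq s -> all (leq 1) s -> head 0 s <= B ->
  alt_sum m s j
  = count (fun i => count (ltn i) s == j %[mod m]) (iota 0 B).
Proof.
move=> jm s_sorted s_pos hB.
rewrite -{1}(conj_seqK s_sorted s_pos) alt_sum_conj ?conj_seq_sorted //.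
rewrite /num_parts_mod /conj_seq count_map -(subnKC hB) iotaD count_cat add0n.
rewrite -[LHS]addn0; congr (_ + _); apply/esym/eqP.
rewrite -leqn0 leqNgt -has_count -all_predC.
apply/allP => i; rewrite mem_iota /= => /andP[hi _].
rewrite -nth_conj_seq // nth_default ?size_mkseq // mod0n modn_small; lia.
Qed.

(** * Inserting equal parts *)

Definition add_parts (k x : nat) (s : seq nat) : seq nat :=
  sort geq (nseq k x ++ s).

Lemma perm_add_parts (k x : nat) (s : seq nat) :
  perm_eq (add_parts k x s) (nseq k x ++ s).
Proof. by rewrite perm_sort. Qed.

Lemma add_parts_sorted (k x : nat) (s : seq nat) : sorted geq (add_parts k x s).
Proof. exact: (sort_sorted geq_total). Qed.

Lemma add_parts_pos (k x : nat) (s : seq nat) :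
  0 < x -> all (leq 1) s -> all (leq 1) (add_parts k x s).
Proof.
move=> x0 s_pos; rewrite (perm_all _ (perm_add_parts k x s)) all_cat s_pos.
by rewrite all_nseq x0 orbT.
Qed.

Lemma count_add_parts (a : pred nat) (k x : nat) (s : seq nat) :
  count a (add_parts k x s) = a x * k + count a s.
Proof. by rewrite (permP (perm_add_parts k x s)) count_cat count_nseq. Qed.

(* Adding [m] parts equal to [x] lengthens the first [x] columns by [m], which
   does not change their lengths modulo [m]. *)
Lemma alt_sum_type_add_parts (m x : nat) (s : seq nat) :
  0 < x -> sorted geq s -> all (leq 1) s ->
  alt_sum_type m (add_parts m x s) = alt_sum_type m s.
Proof.
move=> x0 s_sorted s_pos; apply/eq_in_map => j; rewrite mem_iota => jm.
pose B := maxn (head 0 s) (head 0 (add_parts m x s)).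
rewrite !(@alt_sumE _ _ B) ?leq_maxl ?leq_maxr ?add_parts_sorted //; try lia.
  by apply: eq_count => i /=; rewrite count_add_parts modnMDl.
exact: add_parts_pos.
Qed.

Lemma len_type_add_part (m x : nat) (s : seq nat) :
  len_type m (add_parts 1 (m * x) s) = len_type m s.
Proof.
apply/eq_in_map => j; rewrite mem_iota => jm.
rewrite /num_parts_mod count_add_parts modnMr [j %% m]modn_small; last lia.
by rewrite (_ : (0 == j) = false) //; lia.
Qed.

(** * Cardinalities under conjugation and insertion *)

Definition part_card (P : pred (seq nat)) (n : nat) : nat :=
  #|[set p : intpart n | P p]|.

Lemma intpartP (n : nat) (p : intpart n) :
  [/\ sorted geq p, all (leq 1) p & sumn p = n].
Proof. by have /and3P[? ? /eqP] := valP p. Qed.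

Lemma conj_intpart_proof (n : nat) (p : intpart n) : is_intpart n (conj_seq p).
Proof.
have [p_sorted p_pos p_sum] := intpartP p.
by rewrite /is_intpart conj_seq_sorted conj_seq_pos sumn_conj_seq // p_sum eqxx.
Qed.

Definition conj_intpart (n : nat) (p : intpart n) : intpart n :=
  IntPart (conj_intpart_proof p).

Lemma conj_intpartK (n : nat) : involutive (@conj_intpart n).
Proof.
move=> p; apply: val_inj; have [p_sorted p_pos _] := intpartP p.
exact: conj_seqK.
Qed.

Lemma part_card_conj (m n : nat) (t : seq nat) :
  part_card (fun s => alt_sum_type m s == t) n
  = part_card (fun s => len_type m s == t) n.
Proof.
rewrite /part_card -(card_preimset _ (inv_inj (@conj_intpartK n))).
apply: eq_card => p; rewrite !inE /= alt_sum_type_conj //.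
by have [] := intpartP p.
Qed.

Lemma perm_nseq_cat (T : eqType) (k : nat) (x : T) (s : seq T) :
  k <= count_mem x s -> exists r, perm_eq s (nseq k x ++ r).
Proof.
elim: k s => [|k IH] s ks; first by exists s.
have xs : x \in s by rewrite -has_pred1 has_count; exact: leq_trans ks.
have s_perm := perm_to_rem xs; rewrite (permP s_perm) /= eqxx ltnS in ks.
have [r r_perm] := IH _ ks; exists r.
by rewrite (perm_trans s_perm) //= perm_cons.
Qed.

Lemma add_intpart_proof (k x n : nat) (p : intpart n) :
  0 < x -> is_intpart (k * x + n) (add_parts k x p).
Proof.
move=> x0; have [_ p_pos p_sum] := intpartP p.
rewrite /is_intpart add_parts_sorted add_parts_pos //.
rewrite (perm_sumn (perm_add_parts k x p)) sumn_cat sumn_nseq p_sum.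
by rewrite mulnC eqxx.
Qed.

Definition add_intpart (k x n : nat) (x0 : 0 < x) (p : intpart n) :
  intpart (k * x + n) := IntPart (add_intpart_proof k p x0).

Lemma add_intpart_inj (k x n : nat) (x0 : 0 < x) :
  injective (@add_intpart k x n x0).
Proof.
move=> p q /(congr1 val) /= pq.
have [p_sorted _ _] := intpartP p; have [q_sorted _ _] := intpartP q.
apply/val_inj/(sorted_eq geq_trans geq_anti) => //.
rewrite -(perm_cat2l (nseq k x)) -(permPl (perm_add_parts k x p)) pq.
exact: perm_add_parts.
Qed.

(** Inserting [k] copies of [x] is injective, and its image consists of the partitions with at least
    [k] parts [x]: deleting [k] of these and sorting the rest gives a preimage. *)
Lemma part_card_add (P : pred (seq nat)) (k x n : nat) :
  0 < x ->
  (forall s, sorted geq s -> all (leq 1) s -> P (add_parts k x s) = P s) ->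
  part_card (fun s => P s && (k <= count_mem x s)) (k * x + n)
  = part_card P n.
Proof.
move=> x0 P_add; rewrite /part_card -(card_imset _ (@add_intpart_inj k x n x0)).
apply: eq_card => p; rewrite inE; apply/andP/imsetP => [[Pp]|[q + ->]] /=.
  case/perm_nseq_cat=> r p_perm.
  have [p_sorted p_pos p_sum] := intpartP p.
  have r_part : is_intpart n (sort geq r).
    rewrite /is_intpart (sort_sorted geq_total) all_sort.
    move: p_pos; rewrite (perm_all _ p_perm) all_cat => /andP[_ ->] /=.
    move: p_sum; rewrite (perm_sumn p_perm) sumn_cat sumn_nseq mulnC.
    move=> /addnI <-.
    by apply/eqP/perm_sumn; rewrite perm_sort.
  have p_eq : parts p = add_parts k x (sort geq r).
    apply: (sorted_eq geq_trans geq_anti) => //; first exact: add_parts_sorted.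
    rewrite (perm_trans p_perm) // perm_sym.
    rewrite (perm_trans (perm_add_parts _ _ _)) //.
    by rewrite perm_cat2l perm_sort.
  exists (IntPart r_part); last exact: val_inj.
  have [? ? _] := intpartP (IntPart r_part).
  by rewrite inE -P_add //= -p_eq.
rewrite inE => Pq; have [? ? _] := intpartP q.
by rewrite P_add // count_add_parts /= eqxx mul1n leq_addr.
Qed.

(** * The sieve and its recurrence *)

Definition sieve (P : pred (seq nat)) (k : nat) (e : nat -> nat) (c : nat) :
  pred (seq nat) :=
  fun s => P s && all (fun j => count_mem (e j) s < k) (iota 1 c).

(** Stage [c.+1] discards the partitions with at least [k] parts [e c.+1]. Deleting [k] of these
    parts matches them with the sieved partitions of [n - k * e c.+1]; the test keeps the truncated
    subtraction from counting partitions of 0 when [n] is too small. *)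
Lemma part_card_sieveS (P : pred (seq nat)) (k : nat) (e : nat -> nat)
    (c n : nat) :
  injective e -> 0 < e c.+1 ->
  (forall s, sorted geq s -> all (leq 1) s -> P (add_parts k (e c.+1) s) = P s) ->
  part_card (sieve P k e c.+1) n
  = part_card (sieve P k e c) n
    - (if k * e c.+1 <= n then part_card (sieve P k e c) (n - k * e c.+1) else 0).
Proof.
move=> e_inj e0 P_add.
have -> : part_card (sieve P k e c) n
  = part_card (sieve P k e c.+1) n
    + part_card (fun s => sieve P k e c s && (k <= count_mem (e c.+1) s)) n.
  rewrite /part_card addnC.
  rewrite -(cardsID [set p : intpart n | k <= count_mem (e c.+1) p]).
  congr (_ + _); apply: eq_card => p; rewrite !inE //.
  have iotaS : iota 1 c.+1 = iota 1 c ++ [:: c.+1].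
    by rewrite -(addn1 c) iotaD add1n addn1.
  by rewrite -ltnNge andbC /sieve iotaS all_cat /= andbT andbA.
case: leqP => [kn | nk].
  rewrite [X in _ + X](_ : _ = part_card (sieve P k e c) (n - k * e c.+1)) ?addnK
    //.
  rewrite -[in LHS](subnKC kn) part_card_add // => s s_sorted s_pos.
  rewrite /sieve P_add //; congr (_ && _); apply: eq_in_all => j.
  (* By injectivity, the new parts leave the multiplicities tested at the earlier stages
     unchanged. *)
  rewrite mem_iota count_add_parts /= (inj_eq e_inj) => jc.
  by rewrite (_ : (c.+1 == j) = false) //; lia.
rewrite [X in _ + X](_ : _ = 0) ?addn0 ?subn0 //.
apply/eqP; rewrite cards_eq0; apply/eqP/setP => p; rewrite !inE.
apply/negP => /andP[_ /perm_nseq_cat[r p_perm]].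
have [_ _] := intpartP p.
rewrite (perm_sumn p_perm) sumn_cat sumn_nseq; lia.
Qed.

(** The recurrence sees [k] and [e] only through the products [k * e c.+1]. For modulus [m], the
    pairs [m], [id] and [1], [muln m] share these products: [m] parts [d] weigh as much as one part
    [m * d]. *)
Lemma part_card_sieve_eq (P Q : pred (seq nat)) (k l : nat) (e f : nat -> nat) :
  injective e -> injective f ->
  (forall c, 0 < e c.+1) -> (forall c, 0 < f c.+1) ->
  (forall c, k * e c.+1 = l * f c.+1) ->
  (forall c s, sorted geq s -> all (leq 1) s -> P (add_parts k (e c.+1) s) = P s) ->
  (forall c s, sorted geq s -> all (leq 1) s -> Q (add_parts l (f c.+1) s) = Q s) ->
  (forall n, part_card P n = part_card Q n) ->
  forall c n, part_card (sieve P k e c) n = part_card (sieve Q l f c) n.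
Proof.
move=> e_inj f_inj e0 f0 ef P_add Q_add PQ; elim=> [|c IH] n.
  transitivity (part_card P n); last rewrite PQ.
    by apply: eq_card => p; rewrite !inE /sieve /= andbT.
  by apply: eq_card => p; rewrite !inE /sieve /= andbT.
rewrite (part_card_sieveS n e_inj (e0 c) (P_add c)).
by rewrite (part_card_sieveS n f_inj (f0 c) (Q_add c)) ef !IH.
Qed.

(** * The completed sieves *)

Lemma sieve_mult_at_most (P : pred (seq nat)) (c n : nat) (p : intpart n) :
  sieve P c.+1 id n p = mult_at_most c p && P p.
Proof.
rewrite /sieve andbC; congr (_ && _).
have [_ p_pos _] := intpartP p; have p_leq := intpart_leq p.
(* All parts lie between 1 and [n], so [n] stages test each of them; absent values have multiplicity
   0. *)
apply/allP/allP => [h x xp | h x _].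
  apply: (h x); rewrite mem_iota.
  by have /= := allP p_pos x xp; have /= := allP p_leq x xp; lia.
by case: (boolP (x \in parts p)) => [/h // | /count_memPn ->].
Qed.

Lemma sieve_no_part_divisible (P : pred (seq nat)) (m n : nat) (p : intpart n) :
  sieve P 1 (muln m) n p = no_part_divisible m p && P p.
Proof.
rewrite /sieve andbC; congr (_ && _).
have [_ p_pos _] := intpartP p; have p_leq := intpart_leq p.
apply/allP/allP => [h x xp | h j _]; last first.
  rewrite ltnS leqn0; apply/eqP/count_memPn/negP => /h.
  by rewrite dvdn_mulr.
apply/negP => /dvdnP[j x_eq].
have /= x0 := allP p_pos x xp; have /= xn := allP p_leq x xp.
(* A part [j * m] of a partition of [n] has a positive cofactor [j], at most [n], so the sieve has
   tested it. *)
have : j \in iota 1 n.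
  rewrite mem_iota add1n ltnS; move: x0; rewrite x_eq muln_gt0 => /andP[-> m0].
  by rewrite (leq_trans _ xn) // x_eq leq_pmulr.
by move/h; rewrite mulnC -x_eq ltnS leqn0 => /eqP/count_memPn; rewrite xp.
Qed.

Theorem alt_sum_type_len_type (c n : nat) (t : seq nat) :
  #|[set p : intpart n | mult_at_most c p && (alt_sum_type c.+1 p == t)]|
  = #|[set p : intpart n | no_part_divisible c.+1 p && (len_type c.+1 p == t)]|.
Proof.
pose P s := alt_sum_type c.+1 s == t; pose Q s := len_type c.+1 s == t.
transitivity (part_card (sieve P c.+1 id n) n).
  by apply: eq_card => p; rewrite !inE sieve_mult_at_most.
transitivity (part_card (sieve Q 1 (muln c.+1) n) n); last first.
  by apply: eq_card => p; rewrite !inE sieve_no_part_divisible.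
apply: part_card_sieve_eq => // [x y /eqP | d | d s ? ? | d s _ _ | k].
- by rewrite eqn_pmul2l // => /eqP.
- by rewrite mul1n.
- by rewrite /P alt_sum_type_add_parts.
- by rewrite /Q len_type_add_part.
- exact: part_card_conj.
Qed.

Theorem theorem3p1 (Sigma n : nat) (hSigma : 0 < Sigma) :
  #|[set p : intpart n | mult_at_most 2 p
                         && (alt_sum_type 3 p == [:: Sigma; 2])]|
  = #|[set p : intpart n | [&& no_part_divisible 3 p,
                               num_parts_mod 3 1 p == Sigma
                             & num_parts_mod 3 2 p == 2]]|
  /\
  #|[set p : intpart n | mult_at_most 2 p
                         && (alt_sum_type 3 p == [:: 2; Sigma])]|
  = #|[set p : intpart n | [&& no_part_divisible 3 p,
                               num_parts_mod 3 1 p == 2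
                             & num_parts_mod 3 2 p == Sigma]]|.
Proof.
by split; rewrite alt_sum_type_len_type; apply: eq_card => p;
   rewrite !inE /len_type /= !eqseq_cons andbT.
Qed.
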